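(* Let $v\ge t\ge 2$ and $\lambda\ge 1$ be integers and let $X$ be a PSCA$(v,t,\lambda)$. Then for every $w\in[v]$ and every integer $s$ with $1\le s<t$, $$\frac{1}{t!\,\lambda}\sum_{j=0}^{v-1} j^{s}\, d_w(j)=\frac1v\sum_{i=0}^{v-1} i^{s}.$$
   Context: Let $[v]=\{0,\dots,v-1\}$, let $\mathcal{S}_v$ be the set of permutations of $[v]$ (bijections $[v]\to[v]$), and let $\mathcal{S}_{v,t}$ be the set of ordered sequences of $t$ distinct elements of $[v]$. A sequence $s=(s_0,\dots,s_{t-1})\in\mathcal{S}_{v,t}$ is covered by $\pi\in\mathcal{S}_v$ if $\pi^{-1}(s_i)<\pi^{-1}(s_{i+1})$ for $0\le i\le t-2$. A PSCA$(v,t,\lambda)$ is a multiset $X$ of permutations in $\mathcal{S}_v$ such that every sequence in $\mathcal{S}_{v,t}$ is covered by exactly $\lambda$ permutations in $X$ (counted with multiplicity). For a multiset $X$ of permutations of $[v]$, $w\in[v]$ and $0\le i\le v-1$, $d_w(i)=|\{\pi\in X:\pi(i)=w\}|$ (counted with multiplicity). *)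

(* Defs.v *)
From mathcomp Require Import all_boot all_order all_fingroup all_algebra.
From mathcomp Require Import finmap multiset.

Set Implicit Arguments.
Unset Strict Implicit.
Unset Printing Implicit Defensive.

(* [p a] is the element at position [a], so [p^-1 a] is the position of [a];
   [sorted] compares consecutive entries of [s]. *)
Definition covers (v : nat) (p : 'S_v) (s : seq 'I_v) : bool :=
  sorted (fun a b : 'I_v => (p^-1)%g a < (p^-1)%g b) s.

(* [X p] is the multiplicity of [p] in the multiset [X]. *)
Definition is_PSCA (v t lambda : nat) (X : {mset 'S_v}%mset) : Prop :=
  forall s : t.-tuple 'I_v, uniq s ->
    \sum_(p : 'S_v | covers p s) X p = lambda.

Definition occ (v : nat) (X : {mset 'S_v}%mset) (w i : 'I_v) : nat :=
  \sum_(p : 'S_v | p i == w) X p.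

(* Main.v *)
Require Import Defs.
From mathcomp Require Import all_boot all_order all_fingroup all_algebra.
From mathcomp Require Import finmap multiset.

Set Implicit Arguments.
Unset Strict Implicit.
Unset Printing Implicit Defensive.

(** Why the theorem holds.  Write [posn p w] for the position of [w] in [p].
    The left-hand sum is the moment of order [s] of [posn p w] over the
    multiset [X] ([moment_occ]).  Summed over all [w] it is known: each
    permutation of [X] contributes [\sum_i i ^ s], because its positions are a
    rearrangement of [0, ..., v-1] ([sum_moment]), and [X] has
    [t`! * lambda] elements ([PSCA_size]).  So it suffices that the moment does
    not depend on [w] ([PSCA_moment_const]).

    For this, [posn p w ^ s] counts the [s]-tuples of symbols, repetitions
    allowed, all of whose entries precede [w] in [p] ([card_all_before]).  The
    moment is then a sum over tuples [f] of the number of permutations of [X]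
    in which all entries of [f] precede [w] ([momentE]).  That event depends
    only on the relative order of at most [s + 1 <= t] symbols.  A PSCA induces
    each order on a set of [t] symbols equally often ([PSCA_count_pattern]), so
    the number does not change when all symbols are renamed ([PSCA_relabel],
    [PSCA_all_before_relabel]).  Renaming by the transposition of [w] and [w']
    permutes the tuples [f] and turns the moment at [w] into the one at
    [w']. *)

(** * The order that a permutation induces on a list of symbols *)

Definition posn (v : nat) (p : 'S_v) (a : 'I_v) : nat := (p^-1)%g a.

Lemma posn_inj (v : nat) (p : 'S_v) : injective (posn p).
Proof. by move=> a b /val_inj /perm_inj. Qed.

Definition restr_order (v : nat) (p : 'S_v) (T : seq 'I_v) : seq 'I_v :=
  sort (relpre (posn p) leq) T.

Lemma perm_restr_order v (p : 'S_v) T : perm_eq (restr_order p T) T.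
Proof. by rewrite perm_sort. Qed.

(** Each permutation covers exactly one arrangement of the entries of [T]: this
    is what makes the arrangements of [T] classify the permutations. *)
Lemma covers_restr_order v (p : 'S_v) (T s : seq 'I_v) :
  uniq T -> perm_eq s T -> covers p s = (restr_order p T == s).
Proof.
move=> uT sT; have us : uniq s by rewrite (perm_uniq sT).
have le_total : total (relpre (posn p) leq) by move=> a b; apply: leq_total.
rewrite /covers -[LHS]/(sorted (relpre (posn p) ltn) s).
rewrite -sorted_map ltn_sorted_uniq_leq map_inj_uniq ?us; last exact: posn_inj.
rewrite sorted_map /=; apply/idP/eqP => [s_sorted|<-]; last exact: sort_sorted.
apply: (@sorted_eq _ (relpre (posn p) leq)) => //.
- by move=> b a c; apply: leq_trans.
- by move=> a b; rewrite -eqn_leq => /eqP /posn_inj.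
- exact: sort_sorted.
- by rewrite (perm_trans (perm_restr_order p T)) // perm_sym.
Qed.

(** Makes precedence between entries of [T] a function of [restr_order p T]
    alone, so that [PSCA_count_pattern] applies to it. *)
Lemma posn_lt_index v (p : 'S_v) (T : seq 'I_v) a b :
  a \in T -> b \in T ->
  (posn p a < posn p b) =
    (index a (restr_order p T) < index b (restr_order p T)).
Proof.
move=> aT bT; set s := restr_order p T.
have as_ : a \in s by rewrite mem_sort.
have bs : b \in s by rewrite mem_sort.
have le_tr : transitive (relpre (posn p) leq).
  by move=> y x z; apply: leq_trans.
have s_sorted : sorted (relpre (posn p) leq) s.
  by apply: sort_sorted => x y; apply: leq_total.
have le_refl : reflexive (relpre (posn p) leq) by move=> x; apply: leqnn.
have le_index x y : x \in s -> y \in s ->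
    index x s <= index y s -> posn p x <= posn p y.
  by move=> xs ys; apply: (sorted_leq_index le_tr le_refl s_sorted).
case: ltngtP => [ab|ba|/posn_inj ->]; last by rewrite ltnn.
- by apply/esym; rewrite ltnNge; apply/negP => /(le_index _ _ bs as_); rewrite leqNgt ab.
- apply/esym/negbTE; rewrite -leqNgt leqNgt; apply/negP => /ltnW.
  by move=> /(le_index _ _ as_ bs); rewrite leqNgt ba.
Qed.

(** * Equidistribution of the induced orders in a PSCA *)

(** Classify the permutations by the arrangement of [T] that they cover; each
    class has [lambda] elements. *)
Lemma PSCA_count_pattern (v t lambda : nat) (X : {mset 'S_v}%mset)
    (T : seq 'I_v) (P : pred (seq 'I_v)) :
  is_PSCA t lambda X -> uniq T -> size T = t ->
  \sum_(p | P (restr_order p T)) X p =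
    #|[pred s : t.-tuple 'I_v | perm_eq s T && P s]| * lambda.
Proof.
move=> XP uT sT.
have size_ro p : size (restr_order p T) == t by rewrite size_sort sT.
pose ro p : t.-tuple 'I_v := Tuple (size_ro p).
rewrite (partition_big ro [pred s : t.-tuple 'I_v | perm_eq s T && P s]) /=; last first.
  by move=> p Pp; rewrite perm_restr_order.
rewrite -sum_nat_const; apply: eq_bigr => s /andP[sTs Ps].
rewrite -(XP s); last by rewrite (perm_uniq sTs).
apply: eq_bigl => p; rewrite (covers_restr_order p uT sTs) -val_eqE /=.
by case: eqP => [->|_]; rewrite ?Ps ?andbF.
Qed.

(** Both sides count arrangements with weight [lambda], and [g] maps those of
    [T] bijectively onto those of [map g T]. *)
Lemma PSCA_relabel (v t lambda : nat) (X : {mset 'S_v}%mset) (g : 'S_v)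
    (T : seq 'I_v) (P : pred (seq 'I_v)) :
  is_PSCA t lambda X -> uniq T -> size T = t ->
  \sum_(p | P (restr_order p (map g T))) X p =
  \sum_(p | P (map g (restr_order p T))) X p.
Proof.
move=> XP uT sT; have g_inj := @perm_inj _ g.
rewrite (PSCA_count_pattern (T := T) (fun s => P (map g s)) XP) //.
rewrite (PSCA_count_pattern _ XP) ?size_map ?map_inj_uniq //; congr (_ * _).
rewrite -!sum1_card.
have map_tuple_bij : bijective (@map_tuple t _ _ g).
  exists (map_tuple (g^-1)%g) => s; apply: val_inj => /=;
    rewrite -map_comp map_id_in // => x _ /=; first exact: permK.
  exact: permKV.
rewrite (reindex (map_tuple g)) /=; last exact: onW_bij.
apply: eq_bigl => s; rewrite !inE /=; congr (_ && _).
apply/idP/idP; last exact: perm_map.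
by move/(perm_map_inj g_inj).
Qed.

(** Each of the [t`!] arrangements of any fixed [t] symbols accounts for
    [lambda] permutations. *)
Lemma PSCA_size (v t lambda : nat) (X : {mset 'S_v}%mset) :
  t <= v -> is_PSCA t lambda X -> \sum_p X p = t`! * lambda.
Proof.
move=> tv XP; pose T := take t (enum 'I_v).
have sT : size T = t by rewrite size_take size_enum_ord; case: ltngtP tv.
have uT : uniq T by rewrite take_uniq // enum_uniq.
rewrite (PSCA_count_pattern predT XP uT sT); congr (_ * _).
rewrite -[in RHS]sT -size_permutations //.
have szP s : s \in permutations T -> size s == t.
  by rewrite mem_permutations => /perm_size ->; rewrite sT.
rewrite cardE -(size_map val); apply/perm_size/uniq_perm.
- by rewrite map_inj_uniq ?enum_uniq //; apply: val_inj.
- exact: permutations_uniq.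
move=> s; apply/mapP/idP => [[u]|sT'].
  by rewrite mem_enum inE andbT => uT' ->; rewrite mem_permutations.
exists (Tuple (szP s sT')) => //; rewrite mem_enum inE andbT /=.
by rewrite -mem_permutations.
Qed.

Lemma extend_seq_uniq (v t : nat) (B : seq 'I_v) :
  size B <= t <= v ->
  exists T : seq 'I_v, [/\ uniq T, size T = t & {subset B <= T}].
Proof.
case/andP=> Bt tv; pose C := undup B ++ [seq x <- enum 'I_v | x \notin B].
have uC : uniq C.
  rewrite cat_uniq undup_uniq filter_uniq ?enum_uniq // andbT.
  by apply/hasPn => x; rewrite mem_filter mem_undup => /andP[].
have sC : size C = v.
  rewrite -[RHS](size_enum_ord v); apply/perm_size/uniq_perm => //.
    exact: enum_uniq.
  by move=> x; rewrite mem_cat mem_undup mem_filter mem_enum andbT orbN.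
exists (take t C); split; first exact: take_uniq.
  by rewrite size_take sC; case: ltngtP tv.
move=> x xB; rewrite take_cat ltnNge (leq_trans (size_undup B) Bt) /=.
by rewrite mem_cat mem_undup xB.
Qed.

Definition all_before (v : nat) (p : 'S_v) (w : 'I_v) (B : seq 'I_v) :=
  all (fun a => posn p a < posn p w) B.

(** The entries of [B] together with [w] are at most [t] symbols, so they fit
    in a list [T] of exactly [t] symbols, whose induced order decides the
    event. *)
Lemma PSCA_all_before_relabel (v t lambda : nat) (X : {mset 'S_v}%mset)
    (g : 'S_v) (w : 'I_v) (B : seq 'I_v) :
  is_PSCA t lambda X -> size B < t <= v ->
  \sum_(p | all_before p (g w) (map g B)) X p =
  \sum_(p | all_before p w B) X p.
Proof.
move=> XP Btv; have g_inj := @perm_inj _ g.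
have [T [uT sT BT]] : exists T : seq 'I_v,
    [/\ uniq T, size T = t & {subset w :: B <= T}] by apply: extend_seq_uniq.
have wT : w \in T by rewrite BT ?mem_head.
pose P s := all (fun a => index a s < index (g w) s) (map g B).
rewrite (eq_bigl (fun p => P (restr_order p (map g T)))); last first.
  move=> p; apply: eq_in_all => _ /mapP[b bB ->].
  by apply: posn_lt_index; rewrite mem_map // BT // inE bB orbT.
rewrite (PSCA_relabel _ _ XP) //; apply: eq_bigl => p.
rewrite /P all_map; apply: eq_in_all => b bB /=; rewrite !index_map //.
by rewrite -posn_lt_index // BT // inE bB orbT.
Qed.

(** * Moments of the position of a symbol *)

Definition moment (v : nat) (X : {mset 'S_v}%mset) (s : nat) (w : 'I_v) :=
  \sum_(p : 'S_v) X p * posn p w ^ s.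

(** Exactly [posn p w] symbols precede [w].  Because repetitions are allowed the
    count is a plain power rather than a falling factorial. *)
Lemma card_all_before v (p : 'S_v) (w : 'I_v) s :
  #|[pred f : s.-tuple 'I_v | all_before p w f]| = posn p w ^ s.
Proof.
have <- : #|[pred a | posn p a < posn p w]| = posn p w.
  rewrite -sum1_card (reindex_inj (@perm_inj _ p)) /=.
  rewrite (eq_bigl (fun i : 'I_v => i < posn p w)) => [|i]; last first.
    by rewrite inE {1}/posn permK.
  rewrite -(big_ord_widen v (fun=> 1)); last by rewrite ltnW ?ltn_ord.
  by rewrite sum_nat_const card_ord muln1.
(* Tuples are traded for finite functions, whose number is known. *)
rewrite -[X in _ ^ X]card_ord -card_ffun_on -!sum1_card.
pose to_tuple (f : {ffun 'I_s -> 'I_v}) := [tuple f i | i < s].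
have to_tuple_bij : bijective to_tuple.
  exists (fun u => [ffun i => tnth u i]) => [f|u].
    by apply/ffunP => i; rewrite ffunE tnth_mktuple.
  by apply: eq_from_tnth => i; rewrite tnth_mktuple ffunE.
rewrite (reindex to_tuple) /=; last exact: onW_bij.
apply: eq_bigl => f; rewrite inE /all_before all_map.
apply/allP/ffun_onP => f_before i; first by apply: f_before; rewrite mem_enum.
by move=> _; apply: f_before.
Qed.

Lemma momentE v (X : {mset 'S_v}%mset) s w :
  moment X s w =
    \sum_(f : s.-tuple 'I_v) \sum_(p | all_before p w f) X p.
Proof.
rewrite (exchange_big_dep predT) //=; apply: eq_bigr => p _.
by rewrite sum_nat_const card_all_before mulnC.
Qed.

(** The transposition of [w] and [w'] permutes the tuples in [momentE], and
    [PSCA_all_before_relabel] matches the terms. *)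
Lemma PSCA_moment_const (v t lambda : nat) (X : {mset 'S_v}%mset) s w w' :
  is_PSCA t lambda X -> s < t <= v -> moment X s w = moment X s w'.
Proof.
move=> XP stv; pose g := tperm w w'.
have gw : g w = w' by rewrite tpermL.
rewrite !momentE -gw [RHS](reindex (map_tuple g)) /=; last first.
  apply/onW_bij/inv_bij => f; apply: val_inj => /=.
  by rewrite -map_comp map_id_in // => x _ /=; rewrite tpermK.
by apply: eq_bigr => f _; rewrite (PSCA_all_before_relabel _ _ XP) ?size_tuple.
Qed.

(** The symbols [w] occupy every position of [p] exactly once. *)
Lemma sum_moment v (X : {mset 'S_v}%mset) s :
  \sum_w moment X s w = (\sum_p X p) * \sum_(i < v) i ^ s.
Proof.
rewrite exchange_big big_distrl /=; apply: eq_bigr => p _.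
rewrite -big_distrr /= (reindex_inj (@perm_inj _ p)); congr (_ * _).
by apply: eq_bigr => i _; rewrite /posn permK.
Qed.

Lemma moment_occ v (X : {mset 'S_v}%mset) s w :
  \sum_(j < v) j ^ s * occ X w j = moment X s w.
Proof.
rewrite /moment (partition_big (fun p : 'S_v => (p^-1)%g w) predT) //=.
apply: eq_bigr => j _; rewrite big_distrr /=; apply: eq_big => p.
  by rewrite -(inj_eq (@perm_inj _ p) _ j) permKV eq_sym.
by move=> /eqP <-; rewrite /posn permK mulnC.
Qed.

Import GRing.Theory.
Local Open Scope ring_scope.

Theorem theorem2p2 (v t lambda : nat) (X : {mset 'S_v}%mset) :
  (2 <= t <= v)%N -> (1 <= lambda)%N -> is_PSCA t lambda X ->
  forall (w : 'I_v) (s : nat), (1 <= s < t)%N ->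
    1 / (t`! * lambda)%:R * (\sum_(j < v) j%:R ^+ s * (occ X w j)%:R)
      = 1 / v%:R * (\sum_(i < v) i%:R ^+ s) :> rat.
Proof.
case/andP=> t2 tv lambda0 XP w s /andP[_ st].
(* The moment is constant in [w], so its sum over [w] is [v] times it. *)
have key : (moment X s w * v = t`! * lambda * \sum_(i < v) i ^ s)%N.
  rewrite -(PSCA_size tv XP) -sum_moment.
  rewrite (eq_bigr (fun=> moment X s w)) => [|w' _].
    by rewrite sum_nat_const card_ord mulnC.
  by apply: (PSCA_moment_const _ _ XP); rewrite st.
have -> : \sum_(j < v) j%:R ^+ s * (occ X w j)%:R = (moment X s w)%:R :> rat.
  rewrite -moment_occ natr_sum; apply: eq_bigr => j _.
  by rewrite natrM natrX.
have -> : \sum_(i < v) i%:R ^+ s = (\sum_(i < v) i ^ s)%N%:R :> rat.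
  by rewrite natr_sum; apply: eq_bigr => i _; rewrite natrX.
have v0 : v%:R != 0 :> rat.
  by rewrite Num.Theory.pnatr_eq0 -lt0n (leq_trans _ (leq_trans t2 tv)).
have tl0 : (t`! * lambda)%:R != 0 :> rat.
  by rewrite Num.Theory.pnatr_eq0 -lt0n muln_gt0 fact_gt0.
rewrite !mul1r; apply: (mulfI tl0); rewrite mulVKf //.
by apply: (mulIf v0); rewrite -natrM key natrM -mulrA (mulrC _ v%:R) mulVKf.
Qed.
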